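(* Let $p_0,q_0$ be coprime positive integers with $q_0\ge 3$. If $p_0$ is even, put $p:=p_0/2$, $q:=q_0$ (so $q$ is odd); if $p_0$ is odd, put $p:=p_0$, $q:=2q_0$ (so $q$ is even). Let $D_{\theta,k}(E)$ be the characteristic polynomial $\det(B_{\theta,k,\ell}-E)$ and let $\widetilde\Delta(E)$ be the discriminant, both defined in the context for these $p,q$. Then for all $\theta\in[0,1)$, all $k\in\mathbb{R}$ and all $E$: $$D_{\theta,k}(E)=\widetilde\Delta(E)+4(-1)^{(q-1)/2}\sin(2\pi q\theta)\cos(kq)\qquad\text{if } q \text{ is odd},$$ $$D_{\theta,k}(E)=\widetilde\Delta(E)-4\bigl(1-\cos(2\pi q\theta)\bigr)\bigl(1+(-1)^{q/2}\cos(kq)\bigr)\qquad\text{if } q \text{ is even}.$$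
   Context: Let $b(x):=2\sin(2\pi x)$ and $b_n=b_n(\theta):=b\bigl(\tfrac{p}{q}n+\theta\bigr)$ for $n\in\mathbb{Z}$. For $\theta\in[0,1)$, $k\in\mathbb{R}$, $\ell\in\mathbb{Z}$, let $B_{\theta,k,\ell}$ be the $q\times q$ Hermitian matrix $$B_{\theta,k,\ell}:=\begin{pmatrix} 0 & b_{\ell} & 0 & \cdots & 0 & 0 & e^{-ikq}b_{\ell+q-1}\\ b_{\ell} & 0 & b_{\ell+1} & \cdots & 0 & 0 & 0\\ 0 & b_{\ell+1} & 0 & \cdots & 0 & 0 & 0\\ \vdots & \vdots & \vdots & \ddots & \vdots & \vdots & \vdots\\ 0 & 0 & 0 & \cdots & b_{\ell+q-3} & 0 & b_{\ell+q-2}\\ e^{ikq}b_{\ell+q-1} & 0 & 0 & \cdots & 0 & b_{\ell+q-2} & 0 \end{pmatrix},$$ i.e. zero diagonal, sub- and superdiagonal entries $b_\ell,b_{\ell+1},\dots,b_{\ell+q-2}$, corner entries $e^{-ikq}b_{\ell+q-1}$ (top right) and $e^{ikq}b_{\ell+q-1}$ (bottom left), and all other entries zero. The characteristic polynomial $$D_{\theta,k}(E):=\det(B_{\theta,k,\ell}-E)$$ does not depend on $\ell\in\mathbb{Z}$. Let $D^{(0)}_\theta(E):=D_{\theta,\,k=\pi/(2q)}(E)$ (this is the $k$-independent part of $D_{\theta,k}(E)$: $D_{\theta,k}(E)=D^{(0)}_\theta(E)-(-1)^q\, b_0\cdots b_{q-1}\cdot 2\cos(kq)$). The discriminant is $\widetilde\Delta(E):=D^{(0)}_{\theta=0}(E)$,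 a polynomial in $E$ that does not involve $\theta$ or $k$. *)

(* Defs.v *)
From mathcomp Require Import all_boot all_order all_algebra.
From mathcomp Require Import reals trigo.
From mathcomp.real_closed Require Import complex.

Set Implicit Arguments.
Unset Strict Implicit.
Unset Printing Implicit Defensive.

Import Order.TTheory GRing.Theory Num.Theory.

Local Open Scope ring_scope.
Local Open Scope complex_scope.

(** [expi x] is exp(i x), given by Euler's formula. *)
Definition expi {R : realType} (x : R) : R[i] := cos x +i* sin x.

Definition bfun {R : realType} (x : R) : R := 2 * sin (2 * pi * x).

Definition bseq {R : realType} (p q : nat) (theta : R) (n : int) : R :=
  bfun (p%:R / q%:R * n%:~R + theta).

(** Rows and columns are numbered from 0 to q - 1.  The positions singled out
    by the four tests are pairwise distinct when q >= 3. *)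
Definition Bmx {R : realType} (p q : nat) (theta k : R) (l : int) : 'M[R[i]]_q :=
  \matrix_(i < q, j < q)
    if j == i.+1 :> nat then (bseq p q theta (l + i%:Z))%:C
    else if i == j.+1 :> nat then (bseq p q theta (l + j%:Z))%:C
    else if (i == 0%N :> nat) && (j == q.-1 :> nat) then
      expi (- (k * q%:R)) * (bseq p q theta (l + q%:Z - 1))%:C
    else if (i == q.-1 :> nat) && (j == 0%N :> nat) then
      expi (k * q%:R) * (bseq p q theta (l + q%:Z - 1))%:C
    else 0.

(** det (B - E), not det (E - B) as in [char_poly]. *)
Definition Dpoly {R : realType} (p q : nat) (theta k : R) (l : int) (E : R[i])
    : R[i] :=
  \det (Bmx p q theta k l - E%:M).

(** [Dpoly] does not depend on [l] for the [p], [q] of interest; the base point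
    [l = 0] is used here. *)
Definition Dpoly0 {R : realType} (p q : nat) (theta : R) (E : R[i]) : R[i] :=
  Dpoly p q theta (pi / (2 * q%:R)) 0 E.

Definition discriminant {R : realType} (p q : nat) (E : R[i]) : R[i] :=
  Dpoly0 p q 0 E.

(* Main.v *)
Require Import Defs.
From mathcomp Require Import all_boot all_order all_algebra ring zify.
From mathcomp Require Import perm reals trigo.
From mathcomp.real_closed Require Import complex.

Set Implicit Arguments.
Unset Strict Implicit.
Unset Printing Implicit Defensive.

Import Order.TTheory GRing.Theory Num.Theory.

Local Open Scope ring_scope.

(** Put z = exp(2 pi i (p l / q + theta)), r = exp(2 pi i p / q),
    w = exp(i k q), let D = diag(1, r, ..., r^(q-1)) and let V be the cyclic
    shift twisted by w, so that V^q = w and V D = r D V.  Then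
    B = z G + z^-1 H with G = -i (D V + V^-1 D) and H = i (D^-1 V + V^-1 D^-1).
    Since V G V^-1 = r G and V H V^-1 = r^-1 H, the determinant of B - E is
    unchanged by z -> r z, so only z^q, 1 and z^-q occur in it, the extreme
    coefficients being det G and det H.  These are computed from
    (D V + V^-1 D) V = D (V^2 + r^-1) = D (V - d) (V + d) with d^2 = - r^-1 and
    det (V - x) = (-1)^q (x^q - w).  The constant coefficient is eliminated by
    comparison with theta = 0, l = 1: there the corner entries b_q vanish, so
    the determinant does not depend on k. *)

(** * Coefficients at a degree bound and determinants of twisted pencils *)

(** Unlike the leading coefficient, the coefficient at the bound [d] stays multiplicative when some
    factor has smaller degree. *)
Lemma size_coef_prod_bound (F : comNzRingType) (I : Type) (s : seq I)
    (f : I -> {poly F}) d :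
  (forall i, size (f i) <= d.+1)%N ->
  (size (\prod_(i <- s) f i)%R <= (size s * d).+1)%N /\
  (\prod_(i <- s) f i)`_(size s * d) = \prod_(i <- s) (f i)`_d.
Proof.
move=> sf; elim: s => [|i s [IHs IHc]]; first by rewrite !big_nil size_poly1 coef1.
rewrite !big_cons /= mulSn; set g := \prod_(j <- s) f j in IHs IHc *; split.
  apply: leq_trans (size_polyMleq _ _) _.
  have := sf i; move: (size (f i)) (size g) IHs => a b; lia.
rewrite -IHc coefM.
have dlt : (d < (d + size s * d).+1)%N by rewrite ltnS leq_addr.
(* Only index [d] survives in the convolution: below it the coefficient of [g] lies past its bound,
   above it that of [f i] does. *)
rewrite (bigD1 (Ordinal dlt)) //= addKn big1 ?addr0 // => j jd.
have {}jd : (j : nat) != d by [].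
case: (ltnP d j) => dj.
  by rewrite nth_default ?mul0r // (leq_trans (sf i)).
by rewrite [g`_ _]nth_default ?mulr0 // (leq_trans IHs) //; move: (ltn_ord j) jd dj; lia.
Qed.

Lemma size_coef_det_bound (F : comNzRingType) n d (M : 'M[{poly F}]_n) :
  (forall i j, size (M i j) <= d.+1)%N ->
  (size (\det M) <= (n * d).+1)%N /\
  (\det M)`_(n * d) = \det (map_mx (fun p : {poly F} => p`_d) M).
Proof.
move=> sM; have sz (s : 'S_n) :=
  @size_coef_prod_bound F 'I_n (index_enum 'I_n) (fun i => M i (s i)) d
    (fun i => sM i (s i)).
have sI : size (index_enum 'I_n) = n by rewrite -[RHS]card_ord cardE enumT.
rewrite sI in sz; split.
  apply: leq_trans (size_sum _ _ _) _; apply/bigmax_leqP => s _.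
  by rewrite -signr_odd; case: odd; rewrite ?mulN1r ?mul1r ?size_polyN; case: (sz s).
rewrite coef_sum; apply: eq_bigr => s _.
rewrite -signr_odd -[in RHS]signr_odd.
have -> : \prod_i map_mx (fun p : {poly F} => p`_d) M i (s i)
    = (\prod_i M i (s i))`_(n * d).
  by rewrite (sz s).2; apply: eq_bigr => i _; rewrite mxE.
by case: odd; rewrite ?expr1 ?expr0 ?mulN1r ?mul1r ?coefN.
Qed.

(** Here [w] is the root of unity r of the overview. Clearing z^-1 gives P(z) = det (z^2 G - E z +
    H), of degree at most 2(n+1); conjugation by [V] shows P(wX) = P(X), which leaves only the
    exponents 0, n+1 and 2(n+1). *)
Lemma det_twisted_pencil (F : fieldType) n (w : F) (V G H : 'M[F]_n.+1) (E : F) :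
  n.+1.-primitive_root w -> V \in unitmx ->
  V *m G = w *: (G *m V) -> V *m H = w^-1 *: (H *m V) ->
  exists C : F, forall z : F, z != 0 ->
    \det (z *: G + z^-1 *: H - E%:M)
    = \det G * z ^+ n.+1 + C + \det H * z ^- n.+1.
Proof.
move=> wP Vu VG VH.
have w0 : w != 0 by rewrite (prim_root_eq0 wP).
pose M : 'M[{poly F}]_n.+1 :=
  \matrix_(i, j) ((G i j)%:P * 'X^2 - (E *+ (i == j))%:P * 'X + (H i j)%:P).
pose P := \det M.
have ME z : map_mx (horner_eval z) M = z ^+ 2 *: G - (E * z)%:M + H.
  apply/matrixP => i j; rewrite !mxE /horner_eval !hornerE.
  by case: (i == j); rewrite ?mulr1n ?mulr0n /=; ring.
have MC d : map_mx (fun p : {poly F} => p`_d) M = 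
   if d is 2 then G else if d is 1 then - E%:M else if d is 0 then H else 0.
  by apply/matrixP => i j; case: d => [|[|[|d]]];
    rewrite !mxE !coefE /= !(mulr0, mulr1, subr0, sub0r, oppr0, add0r, addr0).
have sM i j : (size (M i j) <= 3)%N.
  by apply/leq_sizeP => -[|[|[|d]]] // _; have /matrixP/(_ i j) := MC d.+3; rewrite !mxE.
have [sP cP] := size_coef_det_bound sM; rewrite MC -/P in cP; rewrite -/P in sP.
have PE z : P.[z] = \det (z ^+ 2 *: G - (E * z)%:M + H).
  by rewrite -ME det_map_mx.
have c0 : P`_0 = \det H.
  by rewrite -horner_coef0 PE expr0n scale0r mulr0 raddf0 subr0 add0r.
(* The commutation relations give w V M(X) = M(wX) V; in determinants w^(n+1) = 1 and det V
   cancels. *)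
have PcP : P \Po (w *: 'X) = P.
  pose Vp := map_mx polyC V; pose Gp := map_mx polyC G; pose Hp := map_mx polyC H.
  pose M' := map_mx (comp_poly (w *: 'X)) M.
  have VM : w%:P *: (map_mx polyC V *m M) = M' *m map_mx polyC V.
    have {}VG : Vp *m Gp = w%:P *: (Gp *m Vp).
      by rewrite -!map_mxM VG map_mxZ.
    have {}VH : Vp *m Hp = w^-1%:P *: (Hp *m Vp).
      by rewrite -!map_mxM VH map_mxZ.
    have -> : M' = (w%:P ^+ 2 * 'X^2) *: Gp - (w%:P * E%:P * 'X)%:M + Hp.
      apply/matrixP => i j; rewrite !mxE comp_polyD comp_polyB !comp_polyM.
      rewrite !comp_polyC comp_polyX -mul_polyC /=.
      by case: (i == j); rewrite ?mulr1n ?mulr0n ?polyC0; ring.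
    have -> : M = 'X^2 *: Gp - (E%:P * 'X)%:M + Hp.
      apply/matrixP => i j; rewrite !mxE /=.
      by case: (i == j); rewrite ?mulr1n ?mulr0n ?polyC0; ring.
    rewrite mulmxDr mulmxBr -!scalemxAr VG VH mul_mx_scalar.
    rewrite mulmxDl mulmxBl -!scalemxAl mul_scalar_mx !scalerDr scalerN !scalerA.
    congr (_ *: _ - _ *: _ + _ ); [by ring | by rewrite mulrA |].
    by rewrite -polyCM divff // scale1r.
  have := congr1 determinant VM.
  rewrite detZ !det_mulmx det_map_mx (det_map_mx (comp_poly (w *: 'X))) -/P.
  rewrite -rmorphXn /= (prim_expr_order wP) mul1r mulrC.
  by move/mulIf/esym; apply; rewrite polyC_eq0 -unitfE -unitmxE.
(* Comparing coefficients gives w^i P_i = P_i, and [w] has order n+1. *)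
have Pc i : P`_i != 0 -> (n.+1 %| i)%N.
  rewrite (prim_order_dvd wP) => Pi; apply/eqP/(mulIf Pi); rewrite mul1r.
  have := congr1 (fun p : {poly F} => p`_i) PcP; rewrite comp_polyE coef_sum.
  have iP : (i < size P)%N by rewrite ltnNge; apply: contra Pi => ?; rewrite nth_default.
  rewrite (bigD1 (Ordinal iP)) //= big1 ?addr0 => [|j ji]; last first.
    have {}ji : (j : nat) != i by [].
    by rewrite exprZn !coefZ coefXn eq_sym (negPf ji) !mulr0.
  by rewrite exprZn !coefZ coefXn eqxx mulr1 mulrC.
exists P`_n.+1 => z z0.
have -> : z *: G + z^-1 *: H - E%:M = z^-1 *: (z ^+ 2 *: G - (E * z)%:M + H).
  rewrite scalerDr scalerBr scalerA expr2 mulKf // scale_scalar_mx [E * z]mulrC mulKf //.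
  by rewrite addrAC.
rewrite detZ -PE.
rewrite {1}(_ : P = (\det G)%:P * 'X^(n.+1 * 2) + (P`_n.+1)%:P * 'X^(n.+1)
                + (\det H)%:P); last first.
  apply/polyP => i; rewrite !(coefD, coefCM, coefXn, coefC).
  have [/dvdnP[k ->]|ni] := boolP (n.+1 %| i)%N; last first.
    rewrite (contraNeq (Pc i) ni).
    case: eqP ni => [-> /negP[]|_ ni]; first exact: dvdn_mulr.
    case: eqP ni => [-> /negP[]|_ ni] //.
    by case: eqP ni => [-> /negP[]|_ ni] //; rewrite !mulr0 !addr0.
  have -> : (k * n.+1 == n.+1)%N = (k == 1)%N by rewrite -[X in _ == X]mul1n eqn_pmul2r.
  rewrite [(n.+1 * 2)%N]mulnC eqn_pmul2r // muln_eq0 orbF.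
  (* The multiples 0, 1, 2 of n+1 carry det H, the constant and det G; beyond them the size bound
     applies. *)
  case: k => [|[|[|k]]] /=; rewrite ?c0; rewrite ?mulr1 ?mulr0 ?add0r ?addr0 //.
  - by rewrite mul1n.
  - by rewrite mulnC cP.
  - by rewrite nth_default //; apply: leq_trans sP _; rewrite mulnC ltn_pmul2r.
rewrite !(hornerD, hornerCM, hornerXn, hornerC) exprVn exprM.
have := expf_neq0 n.+1 z0; move: (z ^+ n.+1) => y y0.
by field.
Qed.

(** * The twisted cyclic shift and its commutation relations *)

(* The inverse of [twisted_shift n w] is the transpose of
   [twisted_shift n w^-1]. *)
Definition twisted_shift (F : fieldType) n (w : F) : 'M[F]_n.+1 :=
  \matrix_(i, j) ((if i == ord_max then w else 1) *+ (j == ordS i)).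

Definition power_diag (F : fieldType) n (r : F) : 'M[F]_n := diag_mx (\row_j r ^+ j).

(** At [r] this is G of the overview up to the factor -i; at [r^-1] it is H up to the factor i. *)
Definition cyclic_jacobi (F : fieldType) n (w r : F) : 'M[F]_n.+1 :=
  power_diag n.+1 r *m twisted_shift n w + (twisted_shift n w^-1)^T *m power_diag n.+1 r.

Lemma mulmx_twisted_shift_tr (F : fieldType) n (w : F) :
  w != 0 -> twisted_shift n w *m (twisted_shift n w^-1)^T = 1%:M.
Proof.
move=> w0; apply/matrixP => i j; rewrite !mxE (bigD1 (ordS i)) //= big1 => [|k /negPf ki].
  rewrite !mxE eqxx (inj_eq (@ordS_inj _)) addr0 mulr1n.
  case: (eqVneq i j) => [<-|_]; rewrite ?mulr0 // !mulr1n.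
  by case: ifP => _; rewrite ?divff ?mulr1.
by rewrite mxE ki mul0r.
Qed.

Lemma mulmx_tr_twisted_shift (F : fieldType) n (w : F) :
  w != 0 -> (twisted_shift n w^-1)^T *m twisted_shift n w = 1%:M.
Proof. by move=> w0; rewrite (mulmx1C (mulmx_twisted_shift_tr n w0)). Qed.

Lemma twisted_shift_unit (F : fieldType) n (w : F) :
  w != 0 -> twisted_shift n w \in unitmx.
Proof. by move=> w0; case: (mulmx1_unit (mulmx_twisted_shift_tr n w0)). Qed.

(** The shift moves each power of [r] one place along the diagonal; the wrap-around from r^n to r^0
    fits because r^(n+1) = 1. *)
Lemma twisted_shift_power_diag (F : fieldType) n (w r : F) : r ^+ n.+1 = 1 ->
  twisted_shift n w *m power_diag n.+1 r =
  r *: (power_diag n.+1 r *m twisted_shift n w).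
Proof.
move=> r1; apply/matrixP => i j.
rewrite mul_mx_diag mxE [RHS]mxE mul_diag_mx !mxE.
case: (eqVneq j (ordS i)) => [->|_]; rewrite ?mulr0n ?mul0r ?mulr0 //= expr_mod //.
by rewrite exprS mulr1n; ring.
Qed.

Lemma power_diag_tr_twisted_shift (F : fieldType) n (w r : F) : w != 0 -> r ^+ n.+1 = 1 ->
  power_diag n.+1 r *m (twisted_shift n w^-1)^T =
  r *: ((twisted_shift n w^-1)^T *m power_diag n.+1 r).
Proof.
move=> w0 r1; set V' := (twisted_shift _ _)^T.
rewrite -[LHS]mul1mx -(mulmx_tr_twisted_shift n w0) -/V' -!mulmxA.
rewrite [twisted_shift n w *m _]mulmxA twisted_shift_power_diag // -!scalemxAl -!mulmxA.
by rewrite mulmx_twisted_shift_tr // mulmx1 scalemxAr.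
Qed.

(** Used at [r] and at [r^-1], this supplies both commutation hypotheses of [det_twisted_pencil]. *)
Lemma twisted_shift_cyclic_jacobi (F : fieldType) n (w r : F) : w != 0 -> r ^+ n.+1 = 1 ->
  twisted_shift n w *m cyclic_jacobi n w r =
  r *: (cyclic_jacobi n w r *m twisted_shift n w).
Proof.
move=> w0 r1; rewrite /cyclic_jacobi mulmxDr mulmxDl scalerDr; congr (_ + _).
  by rewrite mulmxA twisted_shift_power_diag // -scalemxAl.
rewrite mulmxA mulmx_twisted_shift_tr // mul1mx -mulmxA scalemxAr.
by rewrite -twisted_shift_power_diag // mulmxA mulmx_tr_twisted_shift // mul1mx.
Qed.

(** * Closed forms of the extreme determinants *)

(** Expansion along the last row, which holds only w in column 0 and -x in the last column, distinct
    since the size is at least 2. Both minors are triangular, with diagonal entries 1 and -x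
    respectively. *)
Lemma det_twisted_shift_sub (F : fieldType) n (w x : F) :
  \det (twisted_shift n.+1 w - x%:M) = (-1) ^+ n.+2 * (x ^+ n.+2 - w).
Proof.
set A := _ - _.
have AE i j : A i j = (if i == ord_max then w else 1) *+ (j == ordS i) - x *+ (i == j).
  by rewrite !mxE.
have ordSmax : ordS (@ord_max n.+1) = ord0 by apply/val_inj; rewrite /= modnn.
have ordSE (i : 'I_n.+1) : ordS (lift ord_max i) = lift ord0 i.
  by apply/val_inj; rewrite /= /bump leqNgt ltn_ord add0n modn_small // ltnS ltn_ord.
have liftmax (i : 'I_n.+1) : (lift ord_max i == ord_max) = false.
  by rewrite eq_sym (negPf (neq_lift _ _)).
have liftE (i j : 'I_n.+1) : (lift ord_max i == lift ord0 j) = (i == j.+1 :> nat).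
  by rewrite -val_eqE /= /bump leqNgt ltn_ord.
rewrite (expand_det_row A ord_max) (bigD1 ord0) // (bigD1 ord_max) //= big1 ?addr0; last first.
  by move=> j /andP[j0 jm]; rewrite AE ordSmax (negPf j0) eq_sym (negPf jm) subr0 mul0r.
rewrite !AE ordSmax !eqxx /= !mulr1n !mulr0n subr0 sub0r /cofactor.
set L := row' _ (col' ord0 A); set U := row' _ (col' ord_max A).
have -> : \det L = 1.
  rewrite det_trig; last first.
    apply/is_trig_mxP => i j ij; rewrite !mxE liftmax ordSE.
    by rewrite (inj_eq lift_inj) liftE -val_eqE gtn_eqF // ltn_eqF ?subrr // ltnW.
  by apply: big1 => i _; rewrite !mxE liftmax ordSE eqxx liftE ltn_eqF // subr0.
have -> : \det U = (- x) ^+ n.+1.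
  rewrite -det_tr det_trig; last first.
    apply/is_trig_mxP => i j ij; rewrite !mxE liftmax ordSE (inj_eq lift_inj) liftE -val_eqE.
    by rewrite ltn_eqF ?(ltn_trans ij) // gtn_eqF ?subrr.
  rewrite -[X in _ ^+ X]card_ord -prodr_const; apply: eq_bigr => i _.
  by rewrite !mxE liftmax ordSE eqxx liftE ltn_eqF // sub0r.
rewrite /= addn0 addnn -mul2n exprM sqrrN !expr1n mul1r mulr1 (exprNn x).
by rewrite [(-1) ^+ n.+2]exprS [x ^+ n.+2]exprS; ring.
Qed.

(** The factor [(-1) ^+ n.+3 * w] is det V and [r ^+ 'C(n.+2, 2)] is det D; the last two factors
    come from det (V - d) and det (V + d), whose signs cancel. *)
Lemma det_cyclic_jacobi (F : fieldType) n (w r d : F) :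
  w != 0 -> r ^+ n.+2 = 1 -> d ^+ 2 = - r^-1 ->
  \det (cyclic_jacobi n.+1 w r) * ((-1) ^+ n.+3 * w) =
  r ^+ 'C(n.+2, 2) * ((d ^+ n.+2 - w) * ((- d) ^+ n.+2 - w)).
Proof.
move=> w0 r1 d2.
have r0 : r != 0 by apply/eqP => r0; move/eqP: r1; rewrite r0 expr0n eq_sym oner_eq0.
pose V := twisted_shift n.+1 w; pose D := power_diag n.+2 r.
have eT : cyclic_jacobi n.+1 w r *m V = D *m ((V - d%:M) *m (V - (- d)%:M)).
  rewrite mulmxBl !mulmxBr [in RHS]mul_mx_scalar mul_scalar_mx mul_scalar_mx scale_scalar_mx.
  have VDV : (twisted_shift n.+1 w^-1)^T *m D *m V = r^-1 *: D.
    rewrite -[_ *m D](scalerK r0) -power_diag_tr_twisted_shift // -scalemxAl -mulmxA.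
    by rewrite mulmx_tr_twisted_shift // mulmx1.
  rewrite mulmxDl VDV mul_mx_scalar scaleNr mulrN -expr2 d2 opprK -mulmxA.
  by rewrite mulmxN opprK opprB addrACA subrr addr0.
have detV : \det V = (-1) ^+ n.+3 * w.
  have := det_twisted_shift_sub n w 0; rewrite raddf0 subr0 expr0n sub0r => ->.
  by rewrite [in RHS]exprS; ring.
rewrite -detV -det_mulmx eT !det_mulmx !det_twisted_shift_sub det_diag; congr (_ * _).
  by rewrite -bin2_sum big_mkord expr_sum; apply: eq_bigr => i _; rewrite mxE.
by rewrite mulrACA -expr2 exprAC sqrrN !expr1n mul1r.
Qed.

(** For odd N = n+2, N divides ['C(N, 2)], so det D = 1; and d^(2N) = (-r^-1)^N = -1 turns the
    product into w^2 + 1. *)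
Lemma det_cyclic_jacobi_odd (F : numClosedFieldType) n (w r : F) :
  odd n -> w != 0 -> r ^+ n.+2 = 1 -> \det (cyclic_jacobi n.+1 w r) = w + w^-1.
Proof.
move=> on w0 r1; have d2 := sqrtCK (- r^-1).
have := det_cyclic_jacobi w0 r1 d2; move: (sqrtC _) (\det _) d2 => d T d2.
have oN : odd n.+2 by rewrite /= negbK.
have dN : (d ^+ n.+2) ^+ 2 = -1.
  by rewrite exprAC d2 exprNn exprVn r1 invr1 mulr1 -signr_odd oN.
rewrite (bin2odd oN) exprM r1 expr1n mul1r.
rewrite [(- d) ^+ _]exprNn.
rewrite -[(-1) ^+ n.+3]signr_odd -[(-1) ^+ n.+2]signr_odd /= negbK on /=.
rewrite expr0 mul1r mulN1r => e.
apply: (mulIf w0); rewrite e.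
have -> : (d ^+ n.+2 - w) * (- d ^+ n.+2 - w) = w ^+ 2 - (d ^+ n.+2) ^+ 2 by ring.
by rewrite dN; field.
Qed.

(** Now d^N = (-d)^N = -(-1)^m, so the product is the square of w + (-1)^m; det D = r^(m(2m-1)) = -1
    cancels the sign of det V = -w. *)
Lemma det_cyclic_jacobi_even (F : numClosedFieldType) n m (w r : F) :
  n.+2 = m.*2 -> w != 0 -> r ^+ m = -1 ->
  \det (cyclic_jacobi n.+1 w r) = w + w^-1 + 2 * (-1) ^+ m.
Proof.
move=> nm w0 rm; have d2 := sqrtCK (- r^-1).
have r1 : r ^+ n.+2 = 1 by rewrite nm -mul2n mulnC exprM rm sqrrN expr1n.
have := det_cyclic_jacobi w0 r1 d2; move: (sqrtC _) (\det _) d2 => d T d2.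
have eN : odd n = false by have := congr1 odd nm; rewrite odd_double /= negbK.
have dN : d ^+ n.+2 = - (-1) ^+ m.
  by rewrite nm -mul2n exprM d2 [LHS]exprNn exprVn rm invrN1 mulrN1.
have rC : r ^+ 'C(n.+2, 2) = -1.
  by rewrite bin2 nm -doubleMl doubleK exprM rm -signr_odd -nm /= eN.
rewrite rC [(- d) ^+ _]exprNn dN.
rewrite -[(-1) ^+ n.+3]signr_odd -[(-1) ^+ n.+2]signr_odd /= negbK eN expr0 expr1 mul1r !mulN1r.
have : ((-1) ^+ m) ^+ 2 = 1 :> F by rewrite exprAC sqrrN !expr1n.
move: ((-1) ^+ m) => s s2 e.
apply: (mulIf w0); apply: oppr_inj; rewrite -mulrN e.
have -> : w + w^-1 + 2 * s = (w ^+ 2 + s ^+ 2 + 2 * s * w) / w by rewrite s2; field.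
by field.
Qed.

(** * Complex exponentials and the primitive root of unity *)

Section EulerFormula.
Variable R : realType.
Implicit Types x y : R.
Local Open Scope complex_scope.

Lemma expi0 : expi (0 : R) = 1.
Proof. by rewrite /expi cos0 sin0. Qed.

Lemma expiD x y : expi (x + y) = expi x * expi y.
Proof. by apply/eqP; rewrite eq_complex /= cosD sinD eqxx /=; apply/eqP; ring. Qed.

Lemma expi_neq0 x : expi x != 0.
Proof.
apply/eqP => x0; have := expiD x (- x).
by rewrite subrr expi0 x0 mul0r => /eqP; rewrite oner_eq0.
Qed.

Lemma expiN x : expi (- x) = (expi x)^-1.
Proof. by apply: (mulfI (expi_neq0 x)); rewrite -expiD subrr expi0 divff ?expi_neq0. Qed.

Lemma expiMn x n : expi (x *+ n) = expi x ^+ n.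
Proof. by elim: n => [|n IHn]; rewrite ?expi0 // mulrS expiD IHn exprS. Qed.

Lemma expi_pi : expi (pi : R) = -1.
Proof. by rewrite /expi cospi sinpi; apply/eqP; rewrite eq_complex /= oppr0 !eqxx. Qed.

Lemma expi_2pi_int (l : int) : expi (2 * pi * l%:~R : R) = 1.
Proof.
have p2 : expi (2 * pi : R) = 1 by rewrite mulr_natl expiMn expi_pi sqrrN expr1n.
by case: l => n; rewrite ?NegzE ?mulrNz ?mulrN ?expiN -pmulrn mulr_natr expiMn p2 expr1n ?invr1.
Qed.

Lemma cos_expi x : (2 * cos x)%:C = expi x + (expi x)^-1.
Proof.
by rewrite -expiN; apply/eqP; rewrite eq_complex /= cosN sinN; apply/andP; split; apply/eqP; ring.
Qed.

Lemma sin_expi x : (2 * sin x)%:C = - 'i * (expi x - (expi x)^-1).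
Proof.
by rewrite -expiN; apply/eqP; rewrite eq_complex /= cosN sinN; apply/andP; split; apply/eqP; ring.
Qed.

(** If r^n = 1 and p n had residue m > 0 modulo q, then exp(i pi m / q) would square to 1 and have
    zero sine, although 0 < pi m / q < pi. So q divides p n, hence n by coprimality. *)
Lemma expi_prim_root p q : (0 < q)%N -> coprime p q ->
  q.-primitive_root (expi (2 * pi * (p%:R / q%:R)) : R[i]).
Proof.
move=> q0 pq; set r := expi _.
have qR : (q%:R : R) != 0 by rewrite pnatr_eq0 -lt0n.
have rE n : r ^+ n = expi (2 * pi * ((p * n) %% q)%:R / q%:R).
  have e : (p * n)%:R = ((p * n) %/ q)%:R * q%:R + ((p * n) %% q)%:R :> R.
    by rewrite -natrM -natrD -divn_eq.
  rewrite /r -expiMn -mulr_natr -[RHS]mul1r -(expi_2pi_int ((p * n) %/ q)%N) -expiD.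
  congr expi; transitivity (2 * pi * (p * n)%:R / q%:R : R); first by rewrite natrM; field.
  by rewrite e; field.
apply/andP; split=> //; apply/forallP => i; rewrite unity_rootE rE.
apply/eqP; apply/eqP/eqP => [|->]; last by rewrite modnMl mulr0 mul0r expi0.
set m := ((_ * _) %% q)%N => m1.
suff m0 : m = 0%N.
  have : (q %| i.+1)%N by rewrite -(@Gauss_dvdr q p) 1?coprime_sym // /dvdn -/m m0.
  by move/dvdn_leq => /(_ isT) qi; apply/eqP; rewrite eqn_leq qi andbT.
apply/eqP; rewrite -leqn0 leqNgt; apply/negP => mgt0.
have : 0 < sin (pi * m%:R / q%:R : R).
  apply: sin_gt0_pi; rewrite divr_gt0 ?mulr_gt0 ?pi_gt0 ?ltr0n //=.
  by rewrite ltr_pdivrMr ?ltr0n // ltr_pM2l ?pi_gt0 // ltr_nat ltn_pmod.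
have : expi (pi * m%:R / q%:R : R) ^+ 2 = 1.
  by rewrite -m1 -expiMn mulr2n; congr expi; field.
move/eqP; rewrite sqrf_eq1 => /orP[] /eqP [_ ->]; by rewrite ?oppr0 ltxx.
Qed.
End EulerFormula.

(** * Periodic Jacobi matrices as pencils in z *)

Lemma diag_mx_jacobi (F : fieldType) n (w a b z r : F) :
  let d := \row_(j < n.+1) (z * (a * r ^+ j) + z^-1 * (b * r^-1 ^+ j)) in
  diag_mx d *m twisted_shift n w + (twisted_shift n w^-1)^T *m diag_mx d
  = z *: (a *: cyclic_jacobi n w r) + z^-1 *: (b *: cyclic_jacobi n w r^-1).
Proof.
move=> d; have -> : diag_mx d
    = z *: (a *: power_diag n.+1 r) + z^-1 *: (b *: power_diag n.+1 r^-1).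
  apply/matrixP => i j; rewrite !mxE.
  by case: (i == j); rewrite ?mulr1n ?mulr0n ?mulr0 ?addr0.
by rewrite /cyclic_jacobi mulmxDl mulmxDr -!scalemxAl -!scalemxAr addrACA -!scalerDr.
Qed.

(** [C] is chosen before [z]: it may vary with [w] and [E], but not with theta, which will enter
    through [z] alone. *)
Lemma det_jacobi_expansion (F : fieldType) n (w a b r E : F) :
  w != 0 -> n.+1.-primitive_root r ->
  exists C : F, forall z : F, z != 0 ->
    let d := \row_(j < n.+1) (z * (a * r ^+ j) + z^-1 * (b * r^-1 ^+ j)) in
    \det (diag_mx d *m twisted_shift n w + (twisted_shift n w^-1)^T *m diag_mx d - E%:M) =
    a ^+ n.+1 * \det (cyclic_jacobi n w r) * z ^+ n.+1 + C
    + b ^+ n.+1 * \det (cyclic_jacobi n w r^-1) * z ^- n.+1.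
Proof.
move=> w0 rP; have r1 := prim_expr_order rP.
have rV1 : r^-1 ^+ n.+1 = 1 by rewrite exprVn r1 invr1.
have VT c s : s ^+ n.+1 = 1 -> twisted_shift n w *m (c *: cyclic_jacobi n w s) =
    s *: (c *: cyclic_jacobi n w s *m twisted_shift n w).
  move=> s1; rewrite -scalemxAr twisted_shift_cyclic_jacobi //.
  by rewrite -scalemxAl !scalerA mulrC.
have [C CE] := det_twisted_pencil E rP (twisted_shift_unit n w0) (VT a r r1) (VT b _ rV1).
by exists C => z z0 d; rewrite diag_mx_jacobi CE // !detZ.
Qed.

(** * The Bloch matrix and its dependence on theta, k and l *)

Section BlochMatrix.
Variable R : realType.
Implicit Types theta k : R.
Local Open Scope complex_scope.

(** The first product carries the superdiagonal and the bottom left corner, the second the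
    subdiagonal and the top right corner. Size at least 3 keeps these positions disjoint. *)
Lemma Bmx_twisted_shift p n theta k l :
  let d := \row_(j < n.+3) (Defs.bseq p n.+3 theta (l + j%:Z))%:C in
  let w := expi (k * n.+3%:R) in
  Bmx p n.+3 theta k l =
    diag_mx d *m twisted_shift n.+2 w + (twisted_shift n.+2 w^-1)^T *m diag_mx d.
Proof.
have ordSE (i j : 'I_n.+3) : (j == ordS i) =
    (j == i.+1 :> nat) || (i == n.+2 :> nat) && (j == 0%N :> nat).
  rewrite -val_eqE /=; case: (eqVneq (i : nat) n.+2) => [->|i_max].
    by rewrite modnn (ltn_eqF (ltn_ord j)).
  by rewrite modn_small ?orbF // ltn_neqAle eqSS i_max ltn_ord.
have lE : l + n.+3%:Z - 1 = l + n.+2%:Z by rewrite -addrA.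
move=> d w; apply/matrixP => i j.
rewrite /Bmx mxE [RHS]mxE mul_diag_mx mul_mx_diag !mxE !ordSE lE -!val_eqE /= expiN -/w.
have := ltn_ord j; have := ltn_ord i.
move: (nat_of_ord i) (nat_of_ord j) => {}i {}j ilt jlt.
have noloop m : (m == m.+2) = false by rewrite ltn_eqF.
case: (eqVneq j i.+1) jlt => [->|_] jlt /=.
  have -> : (i.+1 == n.+2) && (i == 0%N) = false by case: i {ilt jlt} => [|i]; rewrite ?andbF.
  by rewrite noloop mulr1n mulr0n mul0r addr0 -(eqSS i) (ltn_eqF jlt) mulr1.
case: (eqVneq i j.+1) ilt => [->|_] ilt /=.
  have -> : (j.+1 == n.+2) && (j == 0%N) = false by case: j {ilt jlt} => [|j]; rewrite ?andbF.
  by rewrite mulr1n mulr0n mulr0 add0r -(eqSS j) (ltn_eqF ilt) mul1r.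
case: (eqVneq i 0%N) => [->|_] /=.
  by case: (eqVneq j n.+2) => [->|_]; rewrite /= ?mulr0n ?mulr1n ?mulr0 ?mul0r add0r.
case: (eqVneq i n.+2) => [->|_] /=; last by rewrite andbF !mulr0n mulr0 mul0r add0r.
by case: eqVneq => _; rewrite andbF mulr0n mul0r addr0 ?mulr0n ?mulr0 // mulrC.
Qed.

Lemma bseq_expi p q theta (l : int) (j : nat) :
  let z := expi (2 * pi * (p%:R / q%:R * l%:~R + theta)) in
  let r := expi (2 * pi * (p%:R / q%:R)) in
  (Defs.bseq p q theta (l + j%:Z))%:C = - 'i * (z * r ^+ j - z^-1 * r^-1 ^+ j).
Proof.
move=> z r; rewrite {}/z {}/r /Defs.bseq /bfun sin_expi exprVn -expiMn -!expiN -!expiD.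
congr (_ * (expi _ - expi _)); rewrite -mulr_natr rmorphD /=; ring.
Qed.

(* The two extreme coefficients are introduced as variables a and b: unification
   unfolds explicit determinants over R[i] and does not return. *)
Lemma Dpoly_expansion p n k E : coprime p n.+3 ->
  let T r := \det (cyclic_jacobi n.+2 (expi (k * n.+3%:R)) r) in
  let r := expi (2 * pi * (p%:R / n.+3%:R)) in
  exists a b C, [/\ a = (- 'i) ^+ n.+3 * T r, b = 'i ^+ n.+3 * T r^-1 &
    forall theta l, Dpoly p n.+3 theta k l E =
      a * expi (2 * pi * n.+3%:R * theta) + C + b * (expi (2 * pi * n.+3%:R * theta))^-1].
Proof.
move=> pq T r; have rP : n.+3.-primitive_root r := expi_prim_root R (ltn0Sn n.+2) pq.
pose w := expi (k * n.+3%:R); have w0 : w != 0 := expi_neq0 _.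
have [C CE] := det_jacobi_expansion (- 'i) 'i E w0 rP.
exists ((- 'i) ^+ n.+3 * T r), ('i ^+ n.+3 * T r^-1), C; split=> // theta l.
set z := expi (2 * pi * (p%:R / n.+3%:R * l%:~R + theta)).
have dE : \row_(j < n.+3) (Defs.bseq p n.+3 theta (l + j%:Z))%:C
    = \row_j (z * (- 'i * r ^+ j) + z^-1 * ('i * r^-1 ^+ j)).
  by apply/rowP => j; rewrite [LHS]mxE [RHS]mxE bseq_expi -/z -/r; ring.
rewrite /Dpoly Bmx_twisted_shift dE (CE z) ?expi_neq0 //.
(* Independence of [l] arises here: q (p/q) l = p l is a whole number of turns. *)
have -> : z ^+ n.+3 = expi (2 * pi * n.+3%:R * theta).
  rewrite -[RHS]mul1r -(expi_2pi_int _ (p%:Z * l)) -expiD -expiMn; congr expi.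
  by rewrite -[LHS]mulr_natr intrM -pmulrn; field; rewrite -natrD pnatr_eq0.
by [].
Qed.

Lemma Dpoly_theta0_const_k p n k k' E :
  Dpoly p n.+3 0 k 1 E = Dpoly p n.+3 0 k' 1 E.
Proof.
congr (\det (_ - _)); apply/matrixP => i j; rewrite !mxE.
have -> : Defs.bseq p n.+3 (0 : R) (1 + n.+3%:Z - 1) = 0.
  rewrite /Defs.bseq /bfun.
  (* The angle is 2 pi p; the imaginary part of this equality makes the sine vanish. *)
  have [_ ->] : expi (2 * pi * (p%:R / n.+3%:R * (1 + n.+3%:Z - 1)%:~R + 0) : R) = 1.
    rewrite -(expi_2pi_int _ p); congr expi.
    by rewrite addr0 addrC addKr; field; rewrite -natrD pnatr_eq0.
  by rewrite mulr0.
by rewrite !mulr0.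
Qed.

(** A single [t] serves both ends because the closed forms do not depend on the choice between [r]
    and [r^-1]. *)
Lemma Dpoly_discriminant p n theta k l E t : coprime p n.+3 ->
  let T r := \det (cyclic_jacobi n.+2 (expi (k * n.+3%:R)) r) in
  let r := expi (2 * pi * (p%:R / n.+3%:R)) in
  let y := expi (2 * pi * n.+3%:R * theta) in
  T r = t -> T r^-1 = t ->
  Dpoly p n.+3 theta k l E = discriminant p n.+3 E
   + t * ((- 'i) ^+ n.+3 * (y - 1) + 'i ^+ n.+3 * (y^-1 - 1)).
Proof.
move=> pq T r y Tr Tr'.
have [a [b [C [ea eb CE]]]] := Dpoly_expansion k E pq.
have [a' [b' [C' [_ _ CE']]]] := Dpoly_expansion (pi / (2 * n.+3%:R)) E pq.
(* The discriminant is moved from l = 0 to l = 1, where k can be changed to the given one; both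
   sides then share the constant [C]. *)
rewrite /discriminant /Dpoly0 (CE' 0 0) -(CE' 0 1) (Dpoly_theta0_const_k p n _ k) !CE -/y.
rewrite (etrans ea (congr1 _ Tr)) (etrans eb (congr1 _ Tr')).
by rewrite mulr0 expi0 invr1; ring.
Qed.
End BlochMatrix.

(** * Evaluation for odd and for even q *)

Local Open Scope complex_scope.

Theorem lemma3 (R : realType) (p0 q0 p q : nat)
    (hp0 : (0 < p0)%N) (hq0 : (3 <= q0)%N) (hcop : coprime p0 q0)
    (hp : p = if odd p0 then p0 else (p0 %/ 2)%N)
    (hq : q = if odd p0 then (2 * q0)%N else q0)
    (theta k : R) (htheta : 0 <= theta < 1) (l : int) (E : R[i]) :
  (odd q ->
     Dpoly p q theta k l E =
       discriminant p q E
       + (4 * (-1) ^+ ((q - 1) %/ 2)%N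
            * sin (2 * pi * q%:R * theta) * cos (k * q%:R))%:C) /\
  (~~ odd q ->
     Dpoly p q theta k l E =
       discriminant p q E
       - (4 * (1 - cos (2 * pi * q%:R * theta))
            * (1 + (-1) ^+ (q %/ 2)%N * cos (k * q%:R)))%:C).
Proof.
have pq : coprime p q.
  rewrite hp hq; case: (boolP (odd p0)) => p0odd.
    by rewrite coprimeMr coprimen2 p0odd.
  by apply: coprime_dvdl hcop; apply: dvdn_div; rewrite dvdn2.
have q3 : (3 <= q)%N.
  by rewrite hq; case: (odd p0) => //; apply: leq_trans hq0 _; rewrite leq_pmull.
clear hp0 hq0 hcop htheta hp hq; case: q q3 pq => [|[|[|n]]] // _ pq.
have rP := expi_prim_root R (ltn0Sn n.+2) pq.
have w0 := expi_neq0 (k * n.+3%:R).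
have i2 : 'i ^+ 2 = -1 :> R[i] := sqr_i R.
split=> [oq|eq].
  have on : odd n.+1 by move: oq; rewrite /= negbK.
  have r1 := prim_expr_order rP.
  have rV1 := congr1 GRing.inv r1; rewrite invr1 -exprVn in rV1.
  rewrite (Dpoly_discriminant _ _ _ pq (det_cyclic_jacobi_odd on w0 r1)
    (det_cyclic_jacobi_odd on w0 rV1)).
  rewrite -cos_expi [(- 'i) ^+ _]exprNn -[(-1) ^+ n.+3]signr_odd oq expr1 mulN1r; congr (_ + _).
  (* For odd q, (-i)^q = -i^q, so the bracket is -i^q (y - y^-1), a real sign times 2 sin(2 pi q
     theta). *)
  have -> : 'i ^+ n.+3 = 'i * (-1) ^+ ((n.+3 - 1) %/ 2) :> R[i].
    rewrite -i2 -exprM -exprS; congr (_ ^+ _).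
    by rewrite subn1 divn2 mul2n even_halfK //; move: oq; rewrite /= negbK.
  set s := (-1) ^+ _; set y := expi _.
  transitivity ((2 * cos (k * n.+3%:R))%:C * s * (- 'i * (y - y^-1))); first by ring.
  rewrite -sin_expi (_ : s = ((-1) ^+ ((n.+3 - 1) %/ 2) : R)%:C).
    by rewrite -!rmorphM; congr (_%:C); ring.
  by rewrite rmorphXn rmorphN1.
have nm : n.+3 = (n.+3 %/ 2).*2 by rewrite divn2 even_halfK.
set m := (n.+3 %/ 2)%N in nm *.
(* With q = 2m this power is exp(i pi p), and p is odd, being coprime to an even q. *)
have rm : expi (2 * pi * (p%:R / n.+3%:R)) ^+ m = -1 :> R[i].
  have podd : odd p by rewrite -coprimen2; apply: coprime_dvdr pq; rewrite dvdn2.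
  have -> : (-1 : R[i]) = expi (pi *+ p) by rewrite expiMn expi_pi -signr_odd podd.
  rewrite -expiMn; congr expi.
  have mR : (m%:R : R) != 0 by rewrite pnatr_eq0 -double_eq0 -nm.
  by rewrite [n.+3 in LHS]nm -mul2n natrM -[LHS]mulr_natr -[RHS]mulr_natr; field.
have rVm := congr1 GRing.inv rm.
rewrite invrN1 -exprVn in rVm.
rewrite (Dpoly_discriminant _ _ _ pq (det_cyclic_jacobi_even nm w0 rm)
  (det_cyclic_jacobi_even nm w0 rVm)).
rewrite -cos_expi [(- 'i) ^+ _]exprNn -[(-1) ^+ n.+3]signr_odd (negPf eq) expr0 mul1r; congr (_ + _).
have -> : 'i ^+ n.+3 = (-1) ^+ m :> R[i] by rewrite nm -mul2n exprM i2.
set y := expi _.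
have -> : (-1) ^+ m = ((-1) ^+ m : R)%:C by rewrite rmorphXn rmorphN1.
transitivity (((2 * cos (k * n.+3%:R))%:C + 2 * ((-1) ^+ m : R)%:C)
  * (((-1) ^+ m : R)%:C * (y + y^-1 - 2))); first by ring.
rewrite -cos_expi.
have s2 : ((-1) ^+ m) ^+ 2 = 1 :> R by rewrite exprAC sqrrN !expr1n.
move: ((-1) ^+ m : R) s2 => s s2.
have -> : 2 = (2 : R)%:C by rewrite rmorph_nat.
rewrite -!(rmorphM, rmorphB, rmorphD, rmorphN); congr (_%:C).
set c := cos _; set C := cos _.
(* Here s^2 = 1 turns s c + s^2 into 1 + s c. *)
transitivity (4 * (s * c + s ^+ 2) * (C - 1)); first by ring.
by rewrite s2; ring.
Qed.
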